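(* Let $(C_0,C,\Gamma_1,\Gamma_2)$ be an associative BD-structure on a completely ordered finite set $S$, with $N=|S|$. This structure (together with the complete order) is obtained, up to isomorphism of completely ordered sets with associative BD-structure, by the matrix construction described in the context from some integer $N\times n$-matrix $(m^j_i)$ satisfying conditions (a) and (b) of the context (for some $n$) if and only if $\alpha_0\notin\Gamma_2$ and $C=C_0^k$ for some $k\in\mathbb{Z}$ (relatively prime to $N=|S|$).
   Context: A transitive cyclic permutation of a finite set $S$ is one acting as a single $|S|$-cycle; $\Gamma_{C_0}=\{(s,C_0(s)): s\in S\}$. An associative BD-structure on $S$ is $(C_0,C,\Gamma_1,\Gamma_2)$, with $C_0,C$ transitive cyclic permutations of $S$ and $\Gamma_1,\Gamma_2\subset\Gamma_{C_0}$ proper subsets such that $(C\times C)(\Gamma_1)=\Gamma_2$. A complete (i.e. total) order on $S$ is compatible with $C_0$ if $C_0$ takes every non-maximal element to the next element in this order; then $\alpha_0=(s_{\max},s_{\min})\in\Gamma_{C_0}$, where $s_{\min},s_{\max}$ are the minimal and maximal elements. An associative BD-structure on a completely ordered set $S$ is an associative BD-structure on $S$ such that the order is compatible with $C_0$. Matrices. Let $(m^j_i)$, $i\in\mathbb{Z}/N\mathbb{Z}$, $j=0,\ldots,n-1$, be a matrix of integers, extended to all $j\in\mathbb{Z}$ by the rule $m^{j+n}_i=m^j_{i-1}$. The conditions are: (a) the differences $m^j_i-m^j_{i'}$ (for $i,i'\in\mathbb{Z}/N\mathbb{Z}$) take values only in $\{-1,0,1\}$; (b) for all $i\ne i'$ in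 $\mathbb{Z}/N\mathbb{Z}$ the periodic infinite sequence $(m^j_i-m^j_{i'})_{j\in\mathbb{Z}}$ is not identically $0$, and the occurrences of $1$ and $-1$ in it alternate. Construction. Given such a matrix, equip the set $\{1,\ldots,N\}=\mathbb{Z}/N\mathbb{Z}$ with the complete order $\prec$: $i\prec i'$ if either $m^0_i<m^0_{i'}$, or $m^0_i=m^0_{i'}$ and the first nonzero term in the sequence $(m^j_i-m^j_{i'})$, $j=0,1,\ldots$, is negative. Let $C_0$ be the transitive cyclic permutation compatible with $\prec$, let $C(i)=i-1$, let $$P_1=\{(i,i') : i\neq i',\ m^j_i=m^j_{i'}\text{ for }0<j<n,\text{ and }C(i)\prec C(i')\},$$ and put $\Gamma_1=P_1\cap\Gamma_{C_0}$, $\Gamma_2=(C\times C)(\Gamma_1)$. These data form an associative BD-structure on the completely ordered set $(\{1,\ldots,N\},\prec)$. *)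

(* Defs.v *)
From HB Require Import structures.
From mathcomp Require Import all_boot all_order all_fingroup all_algebra.

Set Implicit Arguments.
Unset Strict Implicit.
Unset Printing Implicit Defensive.

Import Order.TTheory GRing.Theory Num.Theory.
Local Open Scope ring_scope.

(* The order is carried as an explicit strict relation rather than as a
   canonical instance on S: the matrix construction orders 'I_N.+1 by a
   relation different from its canonical order. *)
Record bd_data (S : finType) := BDData {
  bd_lt : rel S;
  bd_C0 : {perm S};
  bd_C : {perm S};
  bd_G1 : {set S * S};
  bd_G2 : {set S * S}
}.

Definition transitive_cyclic (S : finType) (c : {perm S}) : Prop :=
  forall s : S, porbit c s = [set: S].

Definition perm_graph (S : finType) (c : {perm S}) : {set S * S} :=
  [set (s, c s) | s : S].

Definition pair_image (S T : finType) (f : S -> T) (G : {set S * S}) :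
    {set T * T} :=
  [set (f p.1, f p.2) | p in G].

Definition assoc_BD_structure (S : finType) (D : bd_data S) : Prop :=
  [/\ transitive_cyclic (bd_C0 D),
      transitive_cyclic (bd_C D),
      bd_G1 D \proper perm_graph (bd_C0 D),
      bd_G2 D \proper perm_graph (bd_C0 D)
    & pair_image (bd_C D) (bd_G1 D) = bd_G2 D].

Definition strict_complete_order (S : finType) (lt : rel S) : Prop :=
  [/\ irreflexive lt, transitive lt
    & forall x y : S, x != y -> lt x y || lt y x].

Definition is_min (S : finType) (lt : rel S) (s : S) : Prop :=
  forall x : S, x != s -> lt s x.

Definition is_max (S : finType) (lt : rel S) (s : S) : Prop :=
  forall x : S, x != s -> lt x s.

Definition is_next (S : finType) (lt : rel S) (x y : S) : Prop :=
  lt x y /\ forall z : S, ~ (lt x z /\ lt z y).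

Definition compatible (S : finType) (lt : rel S) (c : {perm S}) : Prop :=
  forall x : S, ~ is_max lt x -> is_next lt x (c x).

Definition ordered_BD_structure (S : finType) (D : bd_data S) : Prop :=
  [/\ strict_complete_order (bd_lt D),
      assoc_BD_structure D
    & compatible (bd_lt D) (bd_C0 D)].

Definition bd_isomorphic (S T : finType) (D : bd_data S) (E : bd_data T) :
    Prop :=
  exists f : S -> T,
    [/\ bijective f,
        forall x y : S, bd_lt E (f x) (f y) = bd_lt D x y,
        forall x : S, f (bd_C0 D x) = bd_C0 E (f x),
        forall x : S, f (bd_C D x) = bd_C E (f x)
      & pair_image f (bd_G1 D) = bd_G1 E /\ pair_image f (bd_G2 D) = bd_G2 E].

Definition perm_expz (S : finType) (c : {perm S}) (k : int) : {perm S} :=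
  match k with
  | Posz n => (c ^+ n)%g
  | Negz n => (c ^- n.+1)%g
  end.

(* Z/(N+1)Z is the additive group 'I_N.+1, whose class of 1 is Zp1; unlike
   'Z_N.+1 this has the right cardinality also when N = 0.  The matrix has
   N+1 rows and n+1 columns, the entry m^j_i being m i j. *)
Section MatrixConstruction.

Variables (N n : nat) (m : 'M[int]_(N.+1, n.+1)).

(* m^j_i for all j in Z: write j = q (n+1) + r with 0 <= r < n+1; then
   m^j_i = m^r_(i - q). *)
Definition mx_ext (j : int) (i : 'I_N.+1) : int :=
  m (i - Zp1 *~ (j %/ n.+1%:Z)%Z) (inord `|(j %% n.+1%:Z)%Z|%N).

Lemma mx_ext_entry (j : 'I_n.+1) (i : 'I_N.+1) :
  mx_ext (j : nat)%:Z i = m i j.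
Proof.
by rewrite /mx_ext divz_nat modz_nat divn_small // modn_small // mulr0z subr0
  absz_nat inord_val.
Qed.

Lemma mx_ext_period (j : int) (i : 'I_N.+1) :
  mx_ext (j + n.+1%:Z) i = mx_ext j (i - Zp1).
Proof.
rewrite /mx_ext modzDr divzDr ?dvdzz // divzz /=.
by rewrite mulrzDr mulr1z opprD addrA addrAC.
Qed.

Definition mx_diff (i i' : 'I_N.+1) (j : int) : int := mx_ext j i - mx_ext j i'.

Definition mx_cond_a : Prop :=
  forall (j : int) (i i' : 'I_N.+1), mx_diff i i' j \in [:: -1; 0; 1].

Definition alternating (d : int -> int) : Prop :=
  (forall j j' : int, j < j' -> d j = 1 -> d j' = 1 ->
     exists2 l : int, j < l < j' & d l = -1) /\
  (forall j j' : int, j < j' -> d j = -1 -> d j' = -1 ->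
     exists2 l : int, j < l < j' & d l = 1).

Definition mx_cond_b : Prop :=
  forall i i' : 'I_N.+1, i != i' ->
    (exists j : int, mx_diff i i' j != 0) /\ alternating (mx_diff i i').

Definition mx_prec (i i' : 'I_N.+1) : Prop :=
  mx_ext 0 i < mx_ext 0 i' \/
  mx_ext 0 i = mx_ext 0 i' /\
  exists j : nat, (forall l : nat, (l < j)%N -> mx_diff i i' l%:Z = 0) /\
                  mx_diff i i' j%:Z < 0.

Definition mx_P1 (lt : rel 'I_N.+1) (C : {perm 'I_N.+1}) :
    {set 'I_N.+1 * 'I_N.+1} :=
  [set p : 'I_N.+1 * 'I_N.+1 |
    [&& p.1 != p.2,
        [forall j : 'I_n.+1, (0 < j)%N ==> (m p.1 j == m p.2 j)]
      & lt (C p.1) (C p.2)]].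

(* E is the result of the construction applied to m; these clauses determine
   all components of E. *)
Definition mx_construction (E : bd_data 'I_N.+1) : Prop :=
  [/\ forall i i' : 'I_N.+1, bd_lt E i i' <-> mx_prec i i',
      transitive_cyclic (bd_C0 E) /\ compatible (bd_lt E) (bd_C0 E),
      forall i : 'I_N.+1, bd_C E i = i - Zp1,
      bd_G1 E = mx_P1 (bd_lt E) (bd_C E) :&: perm_graph (bd_C0 E)
    & bd_G2 E = pair_image (bd_C E) (bd_G1 E)].

End MatrixConstruction.

Definition obtained_from_matrix (S : finType) (N : nat) (D : bd_data S) : Prop :=
  exists (n : nat) (m : 'M[int]_(N.+1, n.+1)) (E : bd_data 'I_N.+1),
    [/\ mx_cond_a m, mx_cond_b m, mx_construction m E & bd_isomorphic D E].

(* Main.v *)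
Require Import Defs.
From mathcomp Require Import all_boot all_order all_fingroup all_algebra.
From mathcomp Require Import cyclic zify.

(* Reading the matrix from column [j] on gives an order on Z/(N+1)Z: compare
   two rows at the first column where they differ.  Passing from [j] to [j + 1]
   moves the rows with the larger entry of column [j] in front of the others, by
   the alternation of signs; this is a cyclic rotation, so all these orders have
   the same cyclic successor C0.  The period rule says that C carries the order
   at [n] to the order at 0, so C commutes with C0 and is a power of it.

   Conversely, number S by the order and let C be the translation by k.  A
   column is determined by the first elements t_j, t_(j+1) of two successive
   rotated orders: it is 0 on the cyclic interval from t_j to t_(j+1) and 1 on
   its complement.  The pairs (x, C0 x) which columns 1, ..., n - 1 and the
   condition C x < C (C0 x) exclude are those with C0 x in {t_1, ..., t_n}.
   Hence one lets t_0 = 0 and t_n = - k, which is forced by the period rule, and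
   lets the t_j in between enumerate the pairs outside Gamma_1; the pair ending
   at - k is outside Gamma_1 because alpha_0 is not in Gamma_2. *)

Set Implicit Arguments.
Unset Strict Implicit.
Unset Printing Implicit Defensive.

Import Order.TTheory GRing.Theory Num.Theory.
Local Open Scope ring_scope.

(** * Alternating sign sequences and the comparisons they encode *)

Section SignSequences.

Implicit Types (d e : int -> int) (j : int).

Definition first_neg d j : Prop :=
  exists l : nat,
    (forall l' : nat, (l' < l)%N -> d (j + l'%:Z) = 0) /\ d (j + l%:Z) < 0.

Lemma first_negE d j :
  first_neg d j <-> d j < 0 \/ d j = 0 /\ first_neg d (j + 1).
Proof.
split=> [[[|l] [d0 dneg]]|[dneg|[dj0 [l [d0 dneg]]]]].
- by left; rewrite addr0 in dneg.
- right; split; first by rewrite -[j]addr0; exact: (d0 0%N).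
  exists l; split=> [l' lt_l'l|]; last by rewrite -addrA -intS.
  by rewrite -addrA -intS; exact: d0.
- by exists 0%N; rewrite addr0.
- exists l.+1; split=> [[|l'] lt_l'l|]; first by rewrite addr0.
    by rewrite intS addrA d0.
  by rewrite intS addrA.
Qed.

Lemma first_neg_asym d e j :
  (forall l, e l = - d l) -> first_neg d j -> first_neg e j -> False.
Proof.
move=> eE [l [d0 dl]] [l' [e0 el']].
have [lt_ll'|lt_l'l|eq_ll'] := ltngtP l l'.
- by have := e0 _ lt_ll'; rewrite eE; lia.
- by have := d0 _ lt_l'l; rewrite eE in el'; lia.
- by rewrite eE -eq_ll' in el'; lia.
Qed.

(** After a [-1] at [j] the next nonzero term cannot be [-1] again, since alternation would put a
    [1] before it; so it is [1], and the negated sequence starts with a negative term. *)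
Lemma first_neg_alternating d e j :
    (forall l, d l \in [:: -1; 0; 1]) -> (forall l, e l = - d l) ->
    alternating d -> (exists l : nat, d (j + 1 + l%:Z) != 0) ->
  d j = -1 -> first_neg e (j + 1).
Proof.
move=> dval eE [_ alt] /ex_minnP[l dl minl] dj; exists l.
have d0 l' : (l' < l)%N -> d (j + 1 + l'%:Z) = 0.
  by apply: contraTeq => /minl; rewrite -leqNgt.
split=> [l' /d0 dl'|]; first by rewrite eE dl' oppr0.
rewrite eE oppr_lt0; have := dval (j + 1 + l%:Z).
rewrite !inE (negPf dl) /= => /orP[/eqP dm|/eqP->//].
have [|i /andP[lt_ji lt_il] di] := alt j (j + 1 + l%:Z) _ dj dm; first by lia.
have := d0 (absz (i - j - 1)%R); have -> : j + 1 + (absz (i - j - 1)%R)%:Z = i by lia.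
by rewrite di; lia.
Qed.

(* [P] is the side on which a comparison currently stands: it flips exactly
   when [d] is nonzero, and the sign of [d] tells the direction of the flip. *)
Variables (d : int -> int) (P : int -> bool).
Hypothesis dval : forall j, d j \in [:: -1; 0; 1].
Hypothesis P_zero : forall j, d j = 0 -> P (j + 1) = P j.
Hypothesis P_neg : forall j, d j = -1 -> P j && ~~ P (j + 1).
Hypothesis P_pos : forall j, d j = 1 -> ~~ P j && P (j + 1).
Hypothesis P_flips : forall j, exists l : nat, P (j + l%:Z) != P j.

(** [P] is constant as long as [d] vanishes, so if [P j] holds, the first flip from [j] on goes from
    true to false and has sign [-1]. *)
Lemma flip_first_neg j : first_neg d j <-> P j.
Proof.
split=> [[l]|Pj].
  elim: l j => [|l IHl] j [d0 dl].
    rewrite addr0 in dl; have := dval j; rewrite !inE.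
    by case/or3P=> /eqP dj; [case/andP: (P_neg dj)|lia..].
  rewrite -P_zero; last by rewrite -[j]addr0; exact: (d0 0%N).
  apply: IHl; split=> [l' lt_l'l|]; last by rewrite -addrA -intS.
  by rewrite -addrA -intS; exact: d0.
have [l] := P_flips j; elim: l j Pj => [|l IHl] j Pj.
  by rewrite addr0 eqxx.
rewrite intS addrA => Pl; apply/first_negE; have := dval j; rewrite !inE.
case/or3P=> /eqP dj; first by left; rewrite dj.
  by right; split=> //; apply: IHl; rewrite (P_zero dj).
by case/andP: (P_pos dj); rewrite Pj.
Qed.

Lemma flip_neg_between j (l : nat) :
  P j -> ~~ P (j + l%:Z) -> exists2 i, j <= i < j + l%:Z & d i = -1.
Proof.
elim: l j => [|l IHl] j Pj; first by rewrite addr0 Pj.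
rewrite intS addrA => Pl; have := dval j; rewrite !inE.
case/or3P=> /eqP dj; first by exists j => //; lia.
  by have [||i lt_i di] := IHl (j + 1); rewrite ?P_zero//; exists i => //; lia.
by case/andP: (P_pos dj); rewrite Pj.
Qed.

Lemma flip_pos_between j (l : nat) :
  ~~ P j -> P (j + l%:Z) -> exists2 i, j <= i < j + l%:Z & d i = 1.
Proof.
elim: l j => [|l IHl] j Pj; first by rewrite addr0 (negPf Pj).
rewrite intS addrA => Pl; have := dval j; rewrite !inE.
case/or3P=> /eqP dj; last by exists j => //; lia.
  by case/andP: (P_neg dj); rewrite (negPf Pj).
by have [||i lt_i di] := IHl (j + 1); rewrite ?P_zero//; exists i => //; lia.
Qed.

(** Equal signs are flips in the same direction, and between two of these [P] must flip back. *)
Lemma flip_alternating : alternating d.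
Proof.
split=> j j' lt_jj' dj dj'.
  have /andP[_ Pj1] := P_pos dj; have /andP[Pj' _] := P_pos dj'.
  have [||i lt_i di] := @flip_neg_between (j + 1) (absz (j' - j - 1)%R) => //.
    by have -> : j + 1 + (absz (j' - j - 1)%R)%:Z = j' by lia.
  by exists i => //; lia.
have /andP[_ Pj1] := P_neg dj; have /andP[Pj' _] := P_neg dj'.
have [||i lt_i di] := @flip_pos_between (j + 1) (absz (j' - j - 1)%R) => //.
  by have -> : j + 1 + (absz (j' - j - 1)%R)%:Z = j' by lia.
by exists i => //; lia.
Qed.

Lemma flip_nonzero : exists j, d j != 0.
Proof.
have [l] := P_flips 0; case P0: (P 0) => Pl.
  have [|i _ di] := @flip_neg_between 0 l P0; first by case: (P _) Pl.
  by exists i; lia.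
have [||i _ di] := @flip_pos_between 0 l; rewrite ?P0//.
  by case: (P _) Pl.
by exists i; lia.
Qed.

End SignSequences.

(** * The centralizer of a transitive cycle *)

Section TransitiveCycles.

Variables (S : finType) (c0 : {perm S}).
Hypothesis c0_trans : transitive_cyclic c0.

(** The centralizer of [c0] acts freely: every point is a power of [c0] applied to [s], and powers
    of [c0] pass through [a] and [b]. *)
Lemma commute_transitive_eq (a b : {perm S}) s :
  commute a c0 -> commute b c0 -> a s = b s -> a = b.
Proof.
move=> ca cb ab; apply/permP=> x.
have /porbitP[i ->] : x \in porbit c0 s by rewrite c0_trans.
have cX g : commute g c0 -> g ((c0 ^+ i)%g s) = (c0 ^+ i)%g (g s).
  by move=> /commuteX-/(_ i) cg; rewrite -!permM cg.
by rewrite !cX // ab.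
Qed.

Lemma commute_transitive_expg (a : {perm S}) (s : S) :
  commute a c0 -> exists k, a = (c0 ^+ k)%g.
Proof.
move=> ca; have /porbitP[k ak] : a s \in porbit c0 s by rewrite c0_trans.
by exists k; apply: (@commute_transitive_eq _ _ s) => //; exact/commute_sym/commuteX.
Qed.

Lemma transitive_fixpoint x : c0 x = x -> forall y, y = x.
Proof.
move=> c0x y; have /porbitP[i ->] : y \in porbit c0 x by rewrite c0_trans.
by elim: i => [|i IHi]; rewrite ?perm1 // expgSr permM IHi.
Qed.

Lemma order_transitive (s : S) : #[c0]%g = #|S|.
Proof.
rewrite -cardsT -(c0_trans s) porbitE orbitE card_in_imset //.
move=> _ _ /cycleP[i ->] /cycleP[j ->] eq_ij.
by apply: (commute_transitive_eq _ _ eq_ij); exact/commute_sym/commuteX.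
Qed.

(** Some power of [c0 ^+ k] agrees with [c0] at [s], hence everywhere; so [c0 ^+ k] generates the
    cyclic group of [c0]. *)
Lemma expg_transitive_coprime (s : S) k :
  transitive_cyclic (c0 ^+ k)%g -> coprime k #|S|.
Proof.
move=> ck_trans; rewrite coprime_sym -(order_transitive s) -generator_coprime.
rewrite /generator eqEsubset !cycle_subG mem_cycle andbT.
have /porbitP[l c0l] : c0 s \in porbit (c0 ^+ k)%g s by rewrite ck_trans.
suff c0E : c0 = ((c0 ^+ k) ^+ l)%g by rewrite [X in X \in _]c0E mem_cycle.
apply: commute_transitive_eq c0l => //.
by rewrite -expgM; exact/commute_sym/commuteX.
Qed.

End TransitiveCycles.

(** * Compatible orders and their cyclic orders *)

Definition cyclic_order (T : Type) (r : T -> T -> Prop) (x y z : T) : Prop :=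
  (r x y /\ r y z) \/ (r y z /\ r z x) \/ (r z x /\ r x y).

Section CompatibleOrders.

Variables (S : finType) (lt : rel S) (c0 : {perm S}) (smin smax : S).
Hypothesis lt_order : strict_complete_order lt.
Hypothesis c0_compat : compatible lt c0.
Hypothesis c0_trans : transitive_cyclic c0.
Hypothesis smin_min : is_min lt smin.
Hypothesis smax_max : is_max lt smax.

Let lt_irr : irreflexive lt. Proof. by case: lt_order. Qed.
Let lt_trans : transitive lt. Proof. by case: lt_order. Qed.
Let lt_tot x y : x != y -> lt x y || lt y x.
Proof. by case: lt_order => _ _; exact. Qed.

Lemma lt_smin x : lt x smin = false.
Proof.
apply/negP=> lt_x; have [eq_x|/smin_min lt'] := eqVneq x smin.
  by rewrite eq_x lt_irr in lt_x.
by have := lt_trans lt_x lt'; rewrite lt_irr.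
Qed.

Lemma lt_smax x : lt smax x = false.
Proof.
apply/negP=> lt_x; have [eq_x|/smax_max lt'] := eqVneq x smax.
  by rewrite eq_x lt_irr in lt_x.
by have := lt_trans lt_x lt'; rewrite lt_irr.
Qed.

Lemma compatible_next x : x != smax -> is_next lt x (c0 x).
Proof.
move=> x_neq; apply: c0_compat => /(_ smax); rewrite eq_sym x_neq lt_smax.
by move/(_ isT).
Qed.

Lemma compatible_smax : c0 smax = smin.
Proof.
have [y_max|/compatible_next[]] := eqVneq ((c0^-1)%g smin) smax.
  by rewrite -y_max permKV.
by rewrite permKV lt_smin.
Qed.

Lemma compatible_lt a b :
  (a < #|S|)%N -> (b < #|S|)%N ->
  lt ((c0 ^+ a)%g smin) ((c0 ^+ b)%g smin) = (a < b)%N.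
Proof.
move: a b; have lt_pow a b : (a < b < #|S|)%N ->
    lt ((c0 ^+ a)%g smin) ((c0 ^+ b)%g smin).
  elim: b => // b IHb /andP[lt_ab lt_bS].
  have lt_b : lt ((c0 ^+ b)%g smin) ((c0 ^+ b.+1)%g smin).
    rewrite expgSr permM.
    have [b_max|/compatible_next[]//] := eqVneq ((c0 ^+ b)%g smin) smax.
    (* Reaching [smax] after [b] steps would close the cycle after [b.+1 < #|S|] steps, against the
       order of [c0]. *)
    have : (c0 ^+ b.+1)%g = 1%g.
      apply: (@commute_transitive_eq _ _ c0_trans _ _ smin).
      - exact/commute_sym/commuteX.
      - exact/commute_sym/commute1.
      - by rewrite expgSr permM b_max compatible_smax perm1.
    move/eqP; rewrite -order_dvdn (order_transitive c0_trans smin).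
    by move/dvdn_leq; lia.
  move: lt_ab; rewrite ltnS leq_eqVlt => /predU1P[-> //|lt_ab].
  by apply: lt_trans lt_b; apply: IHb; lia.
move=> a b aS bS; have [lt_ab|lt_ba|->] := ltngtP a b; last exact: lt_irr.
  by rewrite lt_pow // lt_ab.
apply/negP=> lt_ab'; have := lt_trans lt_ab' (lt_pow b a _).
by rewrite lt_irr lt_ba aS; move/(_ isT).
Qed.

(* This property, together with [y != x], characterizes [y = c0 x], so that [c0]
   only depends on the cyclic order. *)
Lemma cyclic_order_c0 x z : ~ cyclic_order lt x z (c0 x).
Proof.
have [->|/compatible_next[lt_x no_z]] := eqVneq x smax.
  by rewrite compatible_smax /cyclic_order lt_smin !lt_smax; case=> [|[|]] [].
case=> [/no_z//|[[_ lt1]|[lt1 _]]].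
  by have := lt_trans lt1 lt_x; rewrite lt_irr.
by have := lt_trans lt1 lt_x; rewrite lt_irr.
Qed.

Lemma cyclic_order_next x y :
  y != x -> c0 x != x -> (forall z, ~ cyclic_order lt x z y) -> y = c0 x.
Proof.
move=> yx wx no_z; apply/eqP/negPn/negP=> yw.
have := @cyclic_order_c0 x y; have := no_z (c0 x); rewrite /cyclic_order.
have := lt_tot yx; have := lt_tot wx; have := lt_tot yw.
by case/orP=> ?; case/orP=> ?; case/orP=> ?; tauto.
Qed.

(** An element cyclically between [c x] and [c (c0 x)] would have its preimage under [c] between [x]
    and [c0 x], where there is none; so [c (c0 x)] is the successor of [c x]. *)
Lemma cyclic_order_commute (c : {perm S}) :
    (forall x y z, cyclic_order lt (c x) (c y) (c z) ->
       cyclic_order lt x y z) ->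
  commute c c0.
Proof.
move=> c_cyc; apply/permP=> x; rewrite !permM.
have [c0x|c0x] := eqVneq (c0 x) x.
  by have all_x := transitive_fixpoint c0_trans c0x; rewrite [LHS]all_x [RHS]all_x.
have c0cx : c0 (c x) != c x.
  apply: contra_neq c0x => /(transitive_fixpoint c0_trans) all_cx.
  by rewrite [LHS]all_cx [RHS]all_cx.
apply/esym/cyclic_order_next; rewrite ?(inj_eq perm_inj) // => z.
by rewrite -[z](permKV c) => /c_cyc; exact: cyclic_order_c0.
Qed.

End CompatibleOrders.

Lemma cyclic_order_rot (T : Type) (r : T -> T -> Prop) x y z :
  cyclic_order r x y z <-> cyclic_order r y z x.
Proof. by rewrite /cyclic_order; tauto. Qed.

(** This and the next lemma are the two ends of a rotation: with [z] above both others, or below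
    both, only the comparison of [x] with [y] matters. *)
Lemma cyclic_order_top (T : Type) (r : T -> T -> Prop) x y z :
  r y z -> ~ r z x -> cyclic_order r x y z <-> r x y.
Proof. by rewrite /cyclic_order; tauto. Qed.

Lemma cyclic_order_bottom (T : Type) (r : T -> T -> Prop) x y z :
  r z x -> ~ r y z -> cyclic_order r x y z <-> r x y.
Proof. by rewrite /cyclic_order; tauto. Qed.

(** * From a matrix to a structure: invariance of the cyclic order *)

Lemma Zp_mulrn_card N (x : 'I_N.+1) : x *+ N.+1 = 0.
Proof. by rewrite Zp_mulrn; apply: val_inj; rewrite /= modnMl. Qed.

Section MatrixToStructure.

Variables (N n : nat) (m : 'M[int]_(N.+1, n.+1)).
Hypothesis m_a : mx_cond_a m.
Hypothesis m_b : mx_cond_b m.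

Let prec j i i' := first_neg (mx_diff m i i') j.

Lemma mx_diffN i i' j : mx_diff m i' i j = - mx_diff m i i' j.
Proof. by rewrite /mx_diff opprB. Qed.

Lemma mx_ext_periodM (q : nat) j i :
  mx_ext m (j + q%:Z * n.+1%:Z) i = mx_ext m j (i - Zp1 *+ q).
Proof.
elim: q i => [|q IHq] i; first by rewrite mul0r addr0 mulr0n subr0.
by rewrite intS mulrDl mul1r addrCA addrC mx_ext_period IHq mulrS opprD addrA.
Qed.

Lemma mx_diff_nonzero_after i i' j :
  i != i' -> exists l : nat, mx_diff m i i' (j + l%:Z) != 0.
Proof.
(* After [N.+1] periods the rows are back in place, so the nonzero term at [j0] recurs; [q] such
   turns carry it to [j] or beyond. *)
move=> /m_b[[j0 dj0] _]; pose q := absz (j - j0)%R.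
exists (absz (j0 + q%:Z * N.+1%:Z * n.+1%:Z - j)%R).
have -> : j + (absz (j0 + q%:Z * N.+1%:Z * n.+1%:Z - j)%R)%:Z =
          j0 + (q * N.+1)%N%:Z * n.+1%:Z by rewrite /q; nia.
rewrite /mx_diff !mx_ext_periodM mulnC mulrnA Zp_mulrn_card.
by rewrite mul0rn !subr0.
Qed.

Lemma mx_prec_first_neg i i' : mx_prec m i i' <-> prec 0 i i'.
Proof.
split=> [[lt_ii'|[_ [j [d0 dj]]]]|].
- by exists 0%N; rewrite addr0 /mx_diff subr_lt0.
- by exists j; split=> [l /d0|]; rewrite add0r.
case=> [[|l] [d0 dl]]; [left|right; split].
- by rewrite addr0 /mx_diff subr_lt0 in dl.
- by apply/eqP; rewrite -subr_eq0; apply/eqP/(d0 0%N).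
- by exists l.+1; split=> [l' /d0|]; [|move: dl]; rewrite add0r.
Qed.

(** If the three rows do not agree in column [j], exactly two of them do. These two keep their
    mutual order, while the third moves from above both to below both or conversely. *)
Lemma cyclic_order_mx_step j x y z :
  cyclic_order (prec j) x y z <-> cyclic_order (prec (j + 1)) x y z.
Proof.
have step i i' :
    [\/ mx_diff m i i' j = 0 /\ (prec j i i' <-> prec (j + 1) i i'),
        [/\ mx_diff m i i' j = -1, prec j i i' & prec (j + 1) i' i] |
        [/\ mx_diff m i i' j = 1, prec j i' i & prec (j + 1) i i']].
  have swap k k' : mx_diff m k k' j = -1 -> prec j k k' /\ prec (j + 1) k' k.
    move=> dj; have kk' : k != k' by apply: contra_eq_neq dj => ->; rewrite /mx_diff subrr.
    split; first by apply/first_negE; left; rewrite dj.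
    apply: first_neg_alternating dj; [by move=> l; exact: m_a|exact: mx_diffN|exact: (m_b kk').2|].
    exact: mx_diff_nonzero_after.
  have := m_a j i i'; rewrite !inE => /or3P[]/eqP dj.
  - by have [] := swap _ _ dj; constructor 2.
  - constructor 1; split=> //; split=> [/first_negE|prec_j1]; first by rewrite dj; case=> [|[]].
    by apply/first_negE; right.
  - by have [|] := swap i' i; [rewrite mx_diffN dj|constructor 3].
have asym k i i' : prec k i i' -> ~ prec k i' i.
  by move=> pr1 pr2; apply: first_neg_asym pr1 pr2 => l; exact: mx_diffN.
have step0 i i' : mx_diff m i i' j = 0 -> prec j i i' <-> prec (j + 1) i i'.
  by move=> dj; have [[]//|[]|[]] := step i i'; rewrite dj.
have step_neq x' y' z' : mx_diff m x' y' j = 0 -> mx_diff m y' z' j != 0 ->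
    cyclic_order (prec j) x' y' z' <-> cyclic_order (prec (j + 1)) x' y' z'.
  move=> dxy dyz; have dzx : mx_diff m z' x' j = - mx_diff m y' z' j.
    by move: dxy; rewrite /mx_diff; lia.
  have [[dj]|[dj yz zy]|[dj zy yz]] := step y' z'; first by rewrite dj in dyz.
    have [[dz _]|[dz _ _]|[_ xz zx]] := step z' x'; [by lia|by lia|].
    apply: iff_trans (cyclic_order_top yz (asym _ _ _ xz)) _.
    apply: iff_trans (step0 _ _ dxy) _.
    exact: iff_sym (cyclic_order_bottom zx (asym _ _ _ zy)).
  have [[dz _]|[_ zx xz]|[dz _ _]] := step z' x'; [by lia| |by lia].
  apply: iff_trans (cyclic_order_bottom zx (asym _ _ _ zy)) _.
  apply: iff_trans (step0 _ _ dxy) _.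
  exact: iff_sym (cyclic_order_top yz (asym _ _ _ xz)).
have dsum : mx_diff m x y j + mx_diff m y z j + mx_diff m z x j = 0.
  by rewrite /mx_diff; lia.
have [dxy|dxy] := eqVneq (mx_diff m x y j) 0.
  have [dyz|/(step_neq _ _ _ dxy)//] := eqVneq (mx_diff m y z j) 0.
  have dzx : mx_diff m z x j = 0 by lia.
  have := step0 _ _ dxy; have := step0 _ _ dyz; have := step0 _ _ dzx.
  by rewrite /cyclic_order => -> -> ->.
have [dyz|dyz] := eqVneq (mx_diff m y z j) 0.
  rewrite (cyclic_order_rot (prec j)) (cyclic_order_rot (prec (j + 1))).
  by apply: step_neq => //; lia.
(* Three numbers equal to [1] or [-1] cannot add up to 0. *)
have dzx : mx_diff m z x j = 0.
  by have := m_a j x y; have := m_a j y z; have := m_a j z x; rewrite !inE; lia.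
rewrite -(cyclic_order_rot (prec j)) -(cyclic_order_rot (prec (j + 1))).
exact: step_neq.
Qed.

(** Subtracting 1 from the rows amounts to advancing by one period of [n.+1] columns, each of which
    preserves the cyclic order. *)
Lemma cyclic_order_mx_sub1 x y z :
  cyclic_order (prec 0) (x - Zp1) (y - Zp1) (z - Zp1) <->
  cyclic_order (prec 0) x y z.
Proof.
have cyc_n (j : nat) : cyclic_order (prec j%:Z) x y z <-> cyclic_order (prec 0) x y z.
  elim: j => // j IHj; rewrite -IHj intS addrC.
  exact: iff_sym (cyclic_order_mx_step _ _ _ _).
have shift i i' : prec 0 (i - Zp1) (i' - Zp1) <-> prec n.+1 i i'.
  have dE j : mx_diff m (i - Zp1) (i' - Zp1) j = mx_diff m i i' (n.+1%:Z + j).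
    by rewrite [n.+1%:Z + j]addrC /mx_diff !mx_ext_period.
  by split=> -[l [d0 dl]]; exists l; (split=> [l' /d0|]; [|move: dl]); rewrite add0r dE.
by rewrite -(cyc_n n.+1) /cyclic_order !shift.
Qed.

End MatrixToStructure.

Lemma obtained_from_matrix_necessary (S : finType) (N : nat) (hN : #|S| = N.+1)
    (D : bd_data S) (hD : ordered_BD_structure D) (smin smax : S)
    (hmin : is_min (bd_lt D) smin) (hmax : is_max (bd_lt D) smax) :
  obtained_from_matrix N D ->
  (smax, smin) \notin bd_G2 D /\
  exists k : int, coprimez k (Posz #|S|) /\ bd_C D = perm_expz (bd_C0 D) k.
Proof.
case: hD => D_order [c0_trans c_trans _ _ CG1] D_compat.
case=> n [m [E [m_a m_b [E_lt _ EC EG1 _] [f [_ f_lt f_C0 f_C [f_G1 _]]]]]].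
have D_prec x y : bd_lt D x y <-> first_neg (mx_diff m (f x) (f y)) 0.
  by rewrite -f_lt; apply: iff_trans (E_lt _ _) _; exact: mx_prec_first_neg.
split.
  (* For a pair of Gamma_1 sent to alpha_0, the order condition in P1 would read [smax] below
     [smin]. *)
  apply/negP; rewrite -CG1 => /imsetP[p p_G1 [smaxE sminE]].
  have : (f p.1, f p.2) \in bd_G1 E by rewrite -f_G1; apply/imsetP; exists p.
  rewrite EG1 => /setIP[+ _]; rewrite inE => /and3P[_ _] /=.
  by rewrite -!f_C f_lt -smaxE (lt_smax D_order hmax).
have c_comm : commute (bd_C D) (bd_C0 D).
  apply: (cyclic_order_commute D_order D_compat c0_trans hmin hmax) => x y z.
  rewrite /cyclic_order !D_prec !f_C !EC.
  by move/(cyclic_order_mx_sub1 m_a m_b).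
have [k Ck] := commute_transitive_expg c0_trans smin c_comm.
exists k; split=> //.
rewrite /coprimez /gcdz /= -/(coprime _ _).
by apply: (expg_transitive_coprime c0_trans smin); rewrite -Ck.
Qed.

(** * Representatives in Z/(N+1)Z and rotations *)

Lemma val_Zp_sub N (a b : 'I_N.+1) :
  (a - b)%R = (if (b <= a)%N then a - b else a + N.+1 - b)%N :> nat.
Proof.
have ltaN := ltn_ord a; have ltbN := ltn_ord b; rewrite /= modnDmr.
case: leqP => [le_ba|lt_ab].
  have -> : (a + (N.+1 - b) = (a - b) + N.+1)%N by lia.
  by rewrite modnDr modn_small //; lia.
by rewrite addnBA ?modn_small //; lia.
Qed.

Lemma val_Zp_succ N (a : 'I_N.+1) : a + Zp1 != 0 -> (a + Zp1)%R = a.+1 :> nat.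
Proof.
have ltaN := ltn_ord a; rewrite -(inj_eq val_inj) /= modnDmr addn1.
have [/modn_small->//|leNa] := ltnP a.+1 N.+1.
by have -> : a.+1 = N.+1; [lia|rewrite modnn].
Qed.

Lemma val_Zp_opp1 N : (- Zp1 : 'I_N.+1)%R = N :> nat.
Proof. by case: N => [|N] //=; rewrite modn_small // subSS subn0 modn_small. Qed.

Lemma Zp_mulrn_inj N k : coprime k N.+1 -> injective (fun i : 'I_N.+1 => i *+ k).
Proof.
move=> co_k i i'; rewrite !Zp_mulrn => /(congr1 val) /= /eqP.
wlog le_ii' : i i' / (i' <= i)%N => [IH eq_ii'|].
  by have [/IH->//|/ltnW/IH->//] := leqP i' i; rewrite eq_sym.
rewrite eqn_mod_dvd ?leq_mul2r ?le_ii' ?orbT// -mulnBl.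
rewrite Gauss_dvdl 1?coprime_sym // => dvd_ii'; have ltiN := ltn_ord i.
have [eq0|/dvdn_leq/(_ dvd_ii')] := posnP (i - i')%N; last by lia.
by apply: ord_inj; lia.
Qed.

(** Subtracting [w] brings the values from [w] on to the front and wraps the smaller ones behind
    them, so a comparison flips exactly when [w] separates the two values. *)
Lemma rotation_flip N (a b w : int -> 'I_N.+1) (d : int -> int) :
    (forall j, a (j + 1) = a j - w j) -> (forall j, b (j + 1) = b j - w j) ->
    (forall j, a j != b j) ->
    (forall j, d j = (w j <= a j)%N%:Z - (w j <= b j)%N%:Z) ->
  [/\ forall j, d j \in [:: -1; 0; 1],
      forall j, d j = 0 -> (a (j + 1)%R < b (j + 1)%R)%N = (a j < b j)%N,
      forall j, d j = -1 -> (a j < b j)%N && ~~ (a (j + 1)%R < b (j + 1)%R)%N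
    & forall j, d j = 1 -> ~~ (a j < b j)%N && (a (j + 1)%R < b (j + 1)%R)%N].
Proof.
move=> aw bw ab dE.
have ab_val j : nat_of_ord (a j) <> b j by move/ord_inj/eqP; rewrite (negPf (ab j)).
split=> j; rewrite dE ?aw ?bw ?val_Zp_sub ?inE; have := ab_val j;
  have := ltn_ord (a j); have := ltn_ord (b j); have := ltn_ord (w j);
  by case: (leqP (w j) (a j)); case: (leqP (w j) (b j)) => //=; lia.
Qed.

(** * The matrix defined by a sequence of splitting points *)

Section SplittingMatrix.

Variables (N k : nat) (s : seq 'I_N.+1).
Hypothesis k_coprime : coprime k N.+1.

Let kappa : 'I_N.+1 := Zp1 *+ k.

(* Row [i] is the element at position [- i k], so that [i - 1] is at the position
   of [i] plus [k]. *)
Definition split_rank (i : 'I_N.+1) : 'I_N.+1 := - (i *+ k).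
Let rho := split_rank.

Definition split_point (j : nat) : 'I_N.+1 := nth 0 (0 :: rcons s (- kappa)) j.
Let t := split_point.

(* The differences are taken modulo N+1, so this is 0 exactly on the cyclic
   interval [t j, t j.+1[; it is constantly 1 when [t j = t j.+1]. *)
Definition split_mx : 'M[int]_(N.+1, (size s).+1) :=
  \matrix_(i, j) ((t j.+1 - t j)%R <= (rho i - t j)%R)%N%:Z.

(** Each period subtracts [kappa]; the seam is consistent because the last point [- kappa] is the
    first point 0 minus [kappa]. *)
Definition split_point_ext (j : int) : 'I_N.+1 :=
  t (absz (j %% (size s).+1%:Z)%Z) - kappa *~ (j %/ (size s).+1%:Z)%Z.
Let T := split_point_ext.

Lemma split_rank_inj : injective rho.
Proof. by move=> i i' /oppr_inj/(Zp_mulrn_inj k_coprime). Qed.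

Lemma split_rank_sub1 i (q : int) : rho (i - Zp1 *~ q) = rho i + kappa *~ q.
Proof. by rewrite /rho /split_rank mulrnBl opprB addrC /kappa !pmulrn mulrzAC. Qed.

Lemma split_point_last : t (size s).+1 = - kappa.
Proof. by rewrite /t /split_point /= nth_rcons ltnn eqxx. Qed.

Lemma split_point_extE (j : nat) (q : int) : (j <= (size s).+1)%N ->
  T (q * (size s).+1%:Z + j%:Z) = t j - kappa *~ q.
Proof.
rewrite leq_eqVlt ltnS => /predU1P[->|le_j].
  rewrite split_point_last -{2}[(size s).+1%:Z]mul1r -mulrDl /T /split_point_ext.
  rewrite modzMl mulzK // /t /split_point /= sub0r mulrzDr mulr1z.
  by rewrite opprD addrC.
rewrite /T /split_point_ext divzMDl // modzMDl modz_small; last by lia.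
by rewrite divz_small ?addr0 //; lia.
Qed.

(** Lowering the row by [q] raises its rank by [kappa *~ q], which has the same effect as lowering
    the points by that amount. *)
Lemma split_mx_ext j i :
  mx_ext split_mx j i = ((T (j + 1) - T j)%R <= (rho i - T j)%R)%N%:Z.
Proof.
set n := size s; set q := (j %/ n.+1%:Z)%Z; set r := absz (j %% n.+1%:Z)%Z.
have lt_r : (r < n.+1)%N by have := ltz_pmod j (isT : 0 < n.+1%:Z); rewrite /r; lia.
have jE : j = q * n.+1%:Z + r%:Z.
  by rewrite {1}(divz_eq j n.+1%:Z) /r gez0_abs // modz_ge0.
have Tj : T j = t r - kappa *~ q by rewrite jE split_point_extE // ltnW.
have Tj1 : T (j + 1) = t r.+1 - kappa *~ q.
  by rewrite jE -addrA addrC [_ + 1]addrC -intS addrC split_point_extE.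
rewrite /mx_ext -/q -/r mxE inordK // split_rank_sub1 Tj Tj1.
by rewrite [t r - kappa *~ q]addrC addrKA opprD opprK addrA.
Qed.

(** Whole periods suffice: each shifts [T] by [- kappa], a generator of Z/(N+1)Z since [k] is
    coprime to [N.+1]. *)
Lemma split_point_ext_onto j v : exists l : nat, T (j + l%:Z) = v.
Proof.
have [g _ gK] := injF_bij (Zp_mulrn_inj k_coprime).
have /= uE := gK (T j - v)%R; set u := g _ in uE.
exists (u * (size s).+1)%N.
rewrite PoszM addrC /T /split_point_ext modzMDl divzMDl // mulrzDr opprD.
rewrite [- _ - _]addrC addrA -/(T j) -pmulrn /kappa mulrnAC.
have -> : Zp1 *+ u = u :> 'I_N.+1 by exact: Zp1_expgz.
by rewrite uE subKr.
Qed.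

Lemma split_mx_flip i i' : i != i' ->
  [/\ forall j, mx_diff split_mx i i' j \in [:: -1; 0; 1],
      alternating (mx_diff split_mx i i'),
      exists j, mx_diff split_mx i i' j != 0
    & first_neg (mx_diff split_mx i i') 0 <-> (rho i < rho i')%N].
Proof.
move=> ii'.
(* [a j] and [b j] are the positions of the two rows in the order rotated to start at [T j]; their
   comparison serves as [P]. *)
pose a j := rho i - T j; pose b j := rho i' - T j; pose w j := T (j + 1) - T j.
have subsub (u v c : 'I_N.+1) : u - c = (u - v) - (c - v) by rewrite opprB subrKA.
have aw j : a (j + 1) = a j - w j by apply: subsub.
have bw j : b (j + 1) = b j - w j by apply: subsub.
have ab j : a j != b j by rewrite (inj_eq (addIr _)) (inj_eq split_rank_inj).
have d_def j : mx_diff split_mx i i' j = (w j <= a j)%N%:Z - (w j <= b j)%N%:Z.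
  by rewrite /mx_diff !split_mx_ext.
have [d_val P0 Pm Pp] := rotation_flip aw bw ab d_def.
(* When [T] meets the rank of a row, that row comes first, so both outcomes of the comparison occur
   from [j] on. *)
have flips (j : int) : exists l : nat,
    (a (j + l%:Z)%R < b (j + l%:Z)%R)%N != (a j < b j)%N.
  have [l Tl] := split_point_ext_onto j (rho i).
  have [l' Tl'] := split_point_ext_onto j (rho i').
  have al : a (j + l%:Z) = 0 by rewrite /a Tl subrr.
  have bl' : b (j + l'%:Z) = 0 by rewrite /b Tl' subrr.
  have [_|_] := ltnP (a j) (b j); first by exists l'; rewrite bl'.
  exists l; have := ab (j + l%:Z); rewrite al eq_sym => b_neq0.
  by rewrite eqbF_neg negbK lt0n.
split=> //.
- exact: flip_alternating d_val P0 Pm Pp.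
- exact: flip_nonzero d_val P0 Pm Pp flips.
- apply: iff_trans (flip_first_neg d_val P0 Pm Pp flips 0) _.
  have T0 : T 0 = 0 by rewrite /T /split_point_ext mod0z div0z subr0.
  by rewrite /a /b T0 !subr0.
Qed.
Lemma split_mx_a : mx_cond_a split_mx.
Proof.
move=> j i i'; have [->|/split_mx_flip[]//] := eqVneq i i'.
by rewrite /mx_diff subrr.
Qed.

Lemma split_mx_b : mx_cond_b split_mx.
Proof. by move=> i i' /split_mx_flip[]. Qed.

Lemma split_mx_prec i i' : mx_prec split_mx i i' <-> (rho i < rho i')%N.
Proof.
apply: iff_trans (mx_prec_first_neg _ _ _) _.
have [->|/split_mx_flip[]//] := eqVneq i i'.
by rewrite ltnn; split=> // -[l [_]]; rewrite /mx_diff subrr ltxx.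
Qed.

(** Put [v = rho i']. If [t j] is not [v], column [j] separates the rows iff [t j.+1 = v]; if
    [t j = v], it separates them unless [t j.+1 = v] too. The order condition says that [v] is not
    [- kappa]. *)
Lemma split_mx_columns i i' : rho i' = rho i + Zp1 ->
  [&& i != i', [forall j : 'I_(size s).+1, (0 < j)%N ==> (split_mx i j == split_mx i' j)]
    & (rho (i - Zp1)%R < rho (i' - Zp1)%R)%N]
  = (rho i' \notin rcons s (- kappa)).
Proof.
move=> ii'; have rho1 x : rho (x - Zp1) = rho x + kappa := split_rank_sub1 x 1.
have entry x (j : 'I_(size s).+1) :
    split_mx x j = ((t j.+1 - t j)%R <= (rho x - t j)%R)%N%:Z by rewrite mxE.
rewrite !rho1 ii'; apply/and3P/idP => [[_ /forallP cols lt_ii']|v_notin].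
  rewrite mem_rcons inE negb_or; have v_kappa : rho i + Zp1 != - kappa.
    by apply: contraTneq lt_ii' => ->; rewrite addNr.
  rewrite v_kappa /=; apply: contra v_kappa => v_s.
  rewrite -split_point_last; have : t (index (rho i + Zp1) s).+1 = rho i + Zp1.
    by rewrite /t /split_point /= nth_rcons index_mem v_s nth_index.
  (* Column 0 is exempt, so an occurrence of [v] is followed forwards: equal entries make it persist
     up to the last point [- kappa]. *)
  have step j : (0 < j <= size s)%N -> t j = rho i + Zp1 -> t j.+1 = rho i + Zp1.
    move=> /andP[j_gt0 le_j] tj; pose jo : 'I_(size s).+1 := @Ordinal (size s).+1 j le_j.
    have /implyP/(_ j_gt0) := cols jo; rewrite !entry -[nat_of_ord jo]/j ii' tj.
    have vK : rho i - (rho i + Zp1) = - Zp1 by rewrite opprD addNKr.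
    rewrite vK subrr val_Zp_opp1 leq_ord; case: leqP => // + _; rewrite leqn0 => /eqP.
    by move=> w0; apply: subr0_eq; apply: ord_inj.
  move: v_s; rewrite -index_mem; move: (index _ _) => l lt_l tl.
  have tE d : (l + d <= size s)%N -> t (l + d).+1 = rho i + Zp1.
    by elim: d => [|d IHd] le_d; rewrite ?addn0 // addnS step ?IHd //; lia.
  by rewrite -(tE (size s - l)%N) subnKC // ltnW.
have v_t j : (j <= size s)%N -> rho i + Zp1 != t j.+1.
  move=> le_j; apply: contraNneq v_notin => ->.
  by rewrite /t /split_point /= mem_nth // size_rcons.
have v_kappa : rho i + kappa + Zp1 != 0.
  by have := v_t _ (leqnn _); rewrite split_point_last -subr_eq0 opprK addrAC.
have lt_ii' : ((rho i + kappa)%R < (rho i + Zp1 + kappa)%R)%N.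
  have -> : rho i + Zp1 + kappa = rho i + kappa + Zp1 by rewrite addrAC.
  by rewrite val_Zp_succ.
split=> //; first by apply: contraTneq lt_ii' => ii; rewrite -ii' ii ltnn.
apply/forallP=> j; apply/implyP=> j_gt0; rewrite !entry ii'.
have le_j : (j <= size s)%N by rewrite -ltnS.
(* Since [t j] is not [v], adding 1 does not wrap around, and the entries could differ only for
   [t j.+1 = v]. *)
have b_neq0 : rho i - t j + Zp1 != 0.
  have := v_t j.-1 (leq_trans (leq_pred j) le_j).
  by rewrite prednK // -subr_eq0 addrAC.
have w_neq : nat_of_ord (t j.+1 - t j)%R != (rho i - t j + Zp1)%R.
  by rewrite eq_sym (inj_eq val_inj) addrAC (inj_eq (addIr _)) v_t.
have vE : rho i + Zp1 - t j = rho i - t j + Zp1 by rewrite addrAC.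
rewrite val_Zp_succ // in w_neq; rewrite vE val_Zp_succ //.
by rewrite [in X in _ == X]leq_eqVlt (negPf w_neq) ltnS.
Qed.


End SplittingMatrix.

(** * Transport of structure along a bijection *)

Lemma mem_pair_image (S T : finType) (f : S -> T) (g : T -> S) (G : {set S * S}) p :
  cancel f g -> cancel g f ->
  (p \in pair_image f G) = ((g p.1, g p.2) \in G).
Proof.
move=> fK gK; apply/imsetP/idP => [[q Gq ->]|Gp] /=.
  by rewrite !fK -surjective_pairing.
by exists (g p.1, g p.2); rewrite //= !gK -surjective_pairing.
Qed.

Lemma mem_perm_graph (S : finType) (c : {perm S}) p :
  (p \in perm_graph c) = (p.2 == c p.1).
Proof.
by case: p => x y; apply/imsetP/eqP => [[z _ [-> ->]]|/= ->] //; exists x.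
Qed.

Section Transport.

Variables (S T : finType) (D : bd_data S) (f : S -> T) (g : T -> S).
Hypotheses (fK : cancel f g) (gK : cancel g f).

Lemma conj_perm_inj (c : {perm S}) : injective (fun x => f (c (g x))).
Proof. by move=> x y /(can_inj fK)/perm_inj/(can_inj gK). Qed.

Definition conj_perm (c : {perm S}) : {perm T} := perm (@conj_perm_inj c).

Definition transport_bd : bd_data T :=
  BDData (fun x y => bd_lt D (g x) (g y)) (conj_perm (bd_C0 D))
    (conj_perm (bd_C D)) (pair_image f (bd_G1 D)) (pair_image f (bd_G2 D)).

Lemma transport_bd_isomorphic : bd_isomorphic D transport_bd.
Proof.
exists f; split=> // [|x y|x|x]; first by exists g.
- by rewrite /= !fK.
- by rewrite /= permE fK.
- by rewrite /= permE fK.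
Qed.

Lemma conj_perm_transitive (c : {perm S}) :
  transitive_cyclic c -> transitive_cyclic (conj_perm c).
Proof.
move=> c_trans x; apply/setP=> y; rewrite inE.
have /porbitP[i gy] : g y \in porbit c (g x) by rewrite c_trans.
apply/porbitP; exists i; apply: (can_inj gK); rewrite gy.
elim: i {gy} => [|i IHi]; first by rewrite !perm1.
by rewrite !expgSr !permM permE fK IHi.
Qed.

Lemma conj_perm_compatible (c : {perm S}) (lt : rel S) :
  compatible lt c -> compatible (fun x y => lt (g x) (g y)) (conj_perm c).
Proof.
move=> c_compat x x_max; have [|lt_x no_z] := c_compat (g x).
  by move=> gx_max; apply: x_max => y yx; apply: gx_max; rewrite (can_eq gK).
by split=> [|z]; rewrite /= permE fK.
Qed.

End Transport.

(** * From a structure to a matrix *)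

Lemma obtained_from_matrix_sufficient (S : finType) (N : nat) (hN : #|S| = N.+1)
    (D : bd_data S) (hD : ordered_BD_structure D) (smin smax : S)
    (hmin : is_min (bd_lt D) smin) (hmax : is_max (bd_lt D) smax) :
  (smax, smin) \notin bd_G2 D -> commute (bd_C D) (bd_C0 D) ->
  obtained_from_matrix N D.
Proof.
case: hD => D_order [c0_trans c_trans G1_proper _ CG1] D_compat.
move=> alpha0 /(commute_transitive_expg c0_trans smin)[k Ck].
have co_k : coprime k N.+1.
  by rewrite -hN; apply: (expg_transitive_coprime c0_trans smin); rewrite -Ck.
pose pos (v : 'I_N.+1) := (bd_C0 D ^+ v)%g smin.
have lt_pos v w : bd_lt D (pos v) (pos w) = (v < w)%N.
  by rewrite (compatible_lt D_order D_compat c0_trans hmin hmax) ?hN.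
have pos_inj : injective pos.
  move=> v w vw; apply: ord_inj; have := lt_pos v w; have := lt_pos w v.
  by rewrite vw lt_pos; lia.
have pos_succ v : pos (v + Zp1) = bd_C0 D (pos v).
  have C0N : (bd_C0 D ^+ N.+1)%g = 1%g.
    by rewrite -hN -(order_transitive c0_trans smin) expg_order.
  by rewrite /pos /= modnDmr expg_mod // addn1 expgSr permM.
have pos_C v : pos (v + Zp1 *+ k) = bd_C D (pos v).
  rewrite Ck; elim: k {Ck co_k} => [|j IHj]; first by rewrite addr0 perm1.
  by rewrite mulrSr addrA pos_succ IHj expgSr permM.
pose g i := pos (split_rank k i).
have g_inj : injective g by move=> i i' /pos_inj/(split_rank_inj co_k).
have [f gK fK] : bijective g by apply: inj_card_bij => //; rewrite hN card_ord.
have g_C i : g (i - Zp1) = bd_C D (g i).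
  by rewrite /g -pos_C -(split_rank_sub1 k i 1).
pose s := [seq v <- enum 'I_N.+1 | (pos (v - Zp1), pos v) \notin bd_G1 D].
have mem_s v : (v \notin rcons s (- (Zp1 *+ k))) = ((pos (v - Zp1), pos v) \in bd_G1 D).
  rewrite mem_rcons inE mem_filter mem_enum inE andbT negb_or negbK.
  (* [C] sends the pair ending at position [- k] to alpha_0, so appending this point to [s] excludes
     no further pair. *)
  have [->|//] := eqVneq; apply/esym/negbTE; apply: contra alpha0 => G1_last.
  rewrite -CG1; apply/imsetP; exists (pos (- (Zp1 *+ k) - Zp1), pos (- (Zp1 *+ k))) => //=.
  rewrite -!pos_C addNr addrAC addNr add0r; congr pair; last by rewrite /pos expg0 perm1.
  (* Position -1 is recognized as [smax] by its successor [smin]. *)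
  apply: (@perm_inj _ (bd_C0 D)); rewrite -pos_succ addNr.
  by rewrite (compatible_smax D_order D_compat hmin hmax) /pos expg0 perm1.
pose E := transport_bd D fK gK.
exists (size s), (split_mx k s), E; split.
- exact: split_mx_a.
- exact: split_mx_b.
- have E_lt i i' : bd_lt E i i' = (split_rank k i < split_rank k i')%N by exact: lt_pos.
  have E_C i : bd_C E i = i - Zp1 by apply: g_inj; rewrite permE fK g_C.
  split=> //.
  + by move=> i i'; rewrite E_lt; exact: iff_sym (split_mx_prec s co_k i i').
  + split; first exact: conj_perm_transitive.
    exact: conj_perm_compatible.
  + apply/setP=> -[i i']; rewrite (mem_pair_image _ _ fK gK) in_setI mem_perm_graph.
    rewrite -[(i, i').1]/i -[(i, i').2]/i'.
    have -> : (i' == bd_C0 E i) = (g i' == bd_C0 D (g i)).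
      by rewrite -(inj_eq g_inj) permE fK.
    (* Off the graph of [C0] neither side contains the pair, as Gamma_1 lies in this graph. *)
    have [gi'|gi'] := eqVneq (g i') _; last first.
      rewrite andbF; apply: contraNF gi' => /(subsetP (proper_sub G1_proper)).
      by rewrite mem_perm_graph.
    have ii' : split_rank k i' = split_rank k i + Zp1.
      by apply: pos_inj; rewrite pos_succ.
    rewrite andbT inE !E_C E_lt (split_mx_columns s co_k ii') mem_s.
    by rewrite {1}ii' addrK.
  + rewrite /= -CG1 /pair_image -!imset_comp; apply: eq_imset => p /=.
    by rewrite !permE !fK.
- exact: transport_bd_isomorphic.
Qed.

Theorem theorem5p3 (S : finType) (N : nat) (hN : #|S| = N.+1) (D : bd_data S)
    (hD : ordered_BD_structure D) (smin smax : S)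
    (hmin : is_min (bd_lt D) smin) (hmax : is_max (bd_lt D) smax) :
  obtained_from_matrix N D <->
  (smax, smin) \notin bd_G2 D /\
  exists k : int, coprimez k (Posz #|S|) /\ bd_C D = perm_expz (bd_C0 D) k.
Proof.
split=> [|[alpha0 [k [_ Ck]]]]; first exact: obtained_from_matrix_necessary.
apply: (obtained_from_matrix_sufficient hN hD hmin hmax alpha0); rewrite Ck.
by apply: commute_sym; case: k {Ck} => k; [exact: commuteX|exact/commuteV/commuteX].
Qed.
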